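(* Let $0<p<1$ and let $X_1,X_2,\dots$ be independent identically distributed random variables with $\mathbf{Pr}(X_i=1)=p$ and $\mathbf{Pr}(X_i=0)=1-p$. Suppose that $\alpha,\beta>0$ are constants such that $$\mathbf{Pr}\left(\left|\frac1n\sum_{i=1}^nX_i-p\right|\ge\varepsilon\right)\le\alpha\exp\{-\beta\varepsilon^2n\}$$ for all integers $n\ge2$ and all $\varepsilon>0$. Then $\alpha\ge1$. *)

(* Defs.v *)
From mathcomp Require Import all_boot all_order all_algebra finmap.
From mathcomp Require Import all_classical all_reals all_analysis.

Set Implicit Arguments.
Unset Strict Implicit.
Unset Printing Implicit Defensive.

Import Order.TTheory GRing.Theory Num.Theory.

Local Open Scope classical_set_scope.
Local Open Scope ring_scope.

(* Mutual independence: the product rule for every finite subfamily. *)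
Definition independent_RVs (d d' : measure_display) (T : measurableType d)
    (T' : measurableType d') (R : realType) (P : probability T R)
    (I : choiceType) (X : I -> {RV P >-> T'}) : Prop :=
  forall (J : {fset I}) (B : I -> set T'),
    (forall i, i \in J -> measurable (B i)) ->
    P (\bigcap_(i in [set` J]) (X i @^-1` B i)) =
      (\prod_(i <- J) P (X i @^-1` B i))%E.

Definition identically_distributed (d d' : measure_display)
    (T : measurableType d) (T' : measurableType d') (R : realType)
    (P : probability T R) (I : Type) (X : I -> {RV P >-> T'}) : Prop :=
  forall (i j : I) (B : set T'), measurable B ->
    distribution P (X i) B = distribution P (X j) B.

(* Main.v *)
Require Import Defs.
From mathcomp Require Import all_boot all_order all_algebra finmap.
From mathcomp Require Import all_classical all_reals all_analysis.
From mathcomp Require Import measurable_realfun lra.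

(** One sample size [n] and one small [eps] suffice.  Almost surely the sum of
    [n] of the variables is a natural number, so the sample mean is a multiple
    of [1 / n].  If [n * p] is not an integer, all multiples of [1 / n] are at
    distance at least some [eps > 0] from [p]; the deviation event then has
    probability 1 and the tail bound reads
    [1 <= alpha * exp (- beta * eps ^ 2 * n)], whose right-hand side is at most
    [alpha].  Such an [n >= 2] exists because [2 * p] and [3 * p] cannot both
    be integers when [0 < p < 1]: their difference is [p]
    ([exists_sample_size_away_from_mean]). *)

Set Implicit Arguments.
Unset Strict Implicit.
Unset Printing Implicit Defensive.

Import Order.TTheory GRing.Theory Num.Theory.

Local Open Scope classical_set_scope.
Local Open Scope ring_scope.

Lemma probability_ae_eq1 (R : realType) (d : measure_display)
    (T : measurableType d) (P : probability T R) (E : set T) :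
  measurable E -> (\forall w \ae P, E w) -> P E = 1%E.
Proof.
move=> mE aeE.
have PEC : P (~` E) = 0%E by apply/negligibleP => //; exact: measurableC.
by rewrite -[E]setCK probability_setC ?PEC ?sube0 //; exact: measurableC.
Qed.

Lemma ae_zero_or_one (R : realType) (d : measure_display)
    (T : measurableType d) (P : probability T R) (p : R) (X : {RV P >-> R}) :
  P [set w | X w = 1] = p%:E -> P [set w | X w = 0] = (1 - p)%:E ->
  \forall w \ae P, X w = 1 \/ X w = 0.
Proof.
move=> X1 X0.
have mX a : measurable [set w | X w = a].
  rewrite -[[set w | _]]/(X @^-1` [set a]) -[_ @^-1` _]setTI.
  by apply: measurable_funP => //; exact: measurable_set1.
have mU : measurable ([set w | X w = 1] `|` [set w | X w = 0]).
  exact: measurableU.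
have disj : [set w | X w = 1] `&` [set w | X w = 0] = set0.
  by apply/seteqP; split=> w //= [-> /eqP]; rewrite oner_eq0.
apply/negligibleP; first exact: measurableC.
have PU : P ([set w | X w = 1] `|` [set w | X w = 0]) = 1%E.
  have -> : 1%E = (p%:E + (1 - p)%:E)%E by rewrite -EFinD addrC subrK.
  by rewrite -X1 -X0; exact: measureU.
by apply: etrans (probability_setC _ mU) _; rewrite PU subee.
Qed.

Lemma sum_zero_one_nat (R : realType) (n : nat) (x : 'I_n -> R) :
  (forall i, x i = 1 \/ x i = 0) -> exists k : nat, \sum_(i < n) x i = k%:R.
Proof.
move=> x01; apply: (big_ind (fun s => exists k : nat, s = k%:R)).
- by exists 0%N.
- by move=> _ _ [k ->] [l ->]; exists (k + l)%N; rewrite natrD.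
- by move=> i _; case: (x01 i) => ->; [exists 1%N | exists 0%N].
Qed.

(** The sample size is 2, except when [p = 1 / 2], where [2 * p] is an integer
    and 3 works instead. *)
Lemma exists_sample_size_away_from_mean (R : realType) (p : R) :
  0 < p < 1 ->
  exists (n : nat) (eps : R), [/\ (2 <= n)%N, 0 < eps &
    forall k : nat, eps <= `|n%:R^-1 * k%:R - p|].
Proof.
move=> /andP[p0 p1]; have [->|pN2] := eqVneq p 2^-1.
  exists 3%N, 6^-1; split=> [//||k]; first by lra.
  (* The multiples of 1/3 closest to 1/2 are 1/3 and 2/3. *)
  rewrite ler_normr; have [k1|k2] := leqP k 1.
    have : k%:R <= 1 :> R by rewrite lern1.
    by move=> ?; apply/orP; right; lra.
  have : 2 <= k%:R :> R by rewrite ler_nat.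
  by move=> ?; apply/orP; left; lra.
exists 2%N, (Num.min p (Num.min (1 - p) `|2^-1 - p|)); split=> [//||k].
  by rewrite !lt_min p0 subr_gt0 p1 normr_gt0 subr_eq0 eq_sym.
case: k => [|[|k]].
- by rewrite mulr0 sub0r normrN (gtr0_norm p0) ge_min lexx.
- by rewrite mulr1 !ge_min lexx !orbT.
- have k2 : 2 <= k.+2%:R :> R by rewrite ler_nat.
  apply: (@le_trans _ _ (1 - p)); first by rewrite !ge_min lexx !orbT.
  by rewrite ler_normr; apply/orP; left; lra.
Qed.

Theorem corollary2 (R : realType) (d : measure_display) (T : measurableType d)
    (P : probability T R) (p : R) (X : nat -> {RV P >-> R})
    (alpha beta : R) :
  0 < p < 1 ->
  independent_RVs X ->
  identically_distributed X ->
  (forall i : nat, P [set w | X i w = 1] = p%:E) ->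
  (forall i : nat, P [set w | X i w = 0] = (1 - p)%:E) ->
  0 < alpha ->
  0 < beta ->
  (forall (n : nat) (eps : R), (2 <= n)%N -> 0 < eps ->
    (P [set w | (eps <= `| n%:R^-1 * (\sum_(i < n) X i w) - p |)%R] <=
      (alpha * expR (- beta * eps ^+ 2 * n%:R))%:E)%E) ->
  1 <= alpha.
Proof.
move=> p01 _ _ X1 X0 alpha0 beta0 tail.
have [n [eps [n2 eps0 away]]] := exists_sample_size_away_from_mean p01.
have deviation_prob1 :
    P [set w | eps <= `|n%:R^-1 * (\sum_(i < n) X i w) - p|] = 1%E.
  apply: probability_ae_eq1.
    have mdev : measurable_fun setT
        (fun w => `|n%:R^-1 * (\sum_(i < n) X i w) - p|).
      apply: measurableT_comp => //; apply: measurable_funB => //.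
      by apply: measurable_funM => //; apply: measurable_sum.
    have := mdev measurableT _ (measurable_itv `[eps, +oo[).
    rewrite setTI; congr measurable.
    by apply/seteqP; split=> w /=; rewrite in_itv /= andbT.
  have ae01 : \forall w \ae P, forall i, X i w = 1 \/ X i w = 0.
    by apply/ae_foralln => i; exact: ae_zero_or_one (X1 i) (X0 i).
  apply: filterS ae01 => w w01.
  have [k sumE] := sum_zero_one_nat (fun i : 'I_n => w01 i).
  by rewrite /= sumE; exact: away.
have := tail n eps n2 eps0; rewrite deviation_prob1 lee_fin => /le_trans; apply.
apply: ler_piMr; first exact: ltW.
rewrite -expR0 ler_expR !mulNr oppr_le0.
by rewrite !mulr_ge0 ?sqr_ge0 // ltW.
Qed.
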